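(* Let $m,n$ be positive integers and let $h=\lceil (m+1)/2\rceil$. No latin square of order $n$ has more than \[ \frac{n\binom{n}{h}}{m\binom{m}{h}} \] subsquares of order $m$.
   Context: A latin square of order $n$ is an $n\times n$ matrix on $n$ symbols in which each symbol occurs exactly once in each row and each column. A subsquare of a latin square $L$ is a submatrix of $L$ (obtained by selecting some set of rows and some set of columns, not necessarily contiguous) that is itself a latin square; its order is its number of rows. *)

(* Defs.v *)
From mathcomp Require Import all_boot all_order all_algebra.

Set Implicit Arguments.
Unset Strict Implicit.
Unset Printing Implicit Defensive.

(* The shape is allowed to be rectangular, so that the predicate applies
   without a cast to submatrices, of type 'M_(#|R|, #|C|); a latin square has
   as many rows as columns, and as many symbols (the set Y) as rows. *)
Definition latin_square (T : finType) (p q : nat) (A : 'M[T]_(p, q)) : bool :=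
  (p == q) &&
  [exists Y : {set T},
    [&& #|Y| == p,
        [forall i : 'I_p, forall j : 'I_q, A i j \in Y],
        [forall y in Y, forall i : 'I_p, #|[set j : 'I_q | A i j == y]| == 1]
      & [forall y in Y, forall j : 'I_q, #|[set i : 'I_p | A i j == y]| == 1]]].

Definition submatrix (T : Type) (n : nat) (L : 'M[T]_n)
    (R C : {set 'I_n}) : 'M[T]_(#|R|, #|C|) :=
  mxsub (fun i : 'I_#|R| => enum_val i) (fun j : 'I_#|C| => enum_val j) L.

(* A subsquare is identified with its pair (set of rows, set of columns). *)
Definition subsquares (T : finType) (n : nat) (L : 'M[T]_n) (m : nat) :
    {set {set 'I_n} * {set 'I_n}} :=
  [set RC : {set 'I_n} * {set 'I_n} |
    (#|RC.1| == m) && latin_square (submatrix L RC.1 RC.2)].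

(* Main.v *)
Require Import Defs.
From mathcomp Require Import all_boot all_order all_algebra.
From mathcomp Require Import zify.

(** A subsquare of order m is determined by one of its columns together with
    any h of its rows, as soon as 2h > m: two subsquares sharing these meet in
    a subsquare of order at least h, and if some row belonged to the first one
    only, then the common symbols would occur in that row, within the columns
    of the first subsquare but outside the common columns, forcing 2h <= m.
    Each subsquare contains m * 'C(m, h) pairs (column, h rows), out of
    n * 'C(n, h) available ones. *)

Import GRing.Theory Num.Theory.
Local Open Scope ring_scope.

Lemma latin_square_inj (T : finType) (p q : nat) (A : 'M[T]_(p, q)) :
  latin_square A ->
  (forall i, injective (A i)) /\ (forall j, injective (A ^~ j)).
Proof.
case/andP=> _ /existsP[Y /and4P[_ /forallP AY /forall_inP rowY /forall_inP colY]].
have inY i j : A i j \in Y by have /forallP := AY i.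
split=> [i j k eq_jk | j i k eq_ik].
  have /forallP/(_ i)/cards1P[x def_x] := rowY _ (inY i j).
  have : j \in [set x] by rewrite -def_x inE.
  have : k \in [set x] by rewrite -def_x inE eq_jk.
  by rewrite !inE => /eqP-> /eqP->.
have /forallP/(_ j)/cards1P[x def_x] := colY _ (inY i j).
have : i \in [set x] by rewrite -def_x inE.
have : k \in [set x] by rewrite -def_x inE eq_ik.
by rewrite !inE => /eqP-> /eqP->.
Qed.

(** Moves from the ordinals indexing a submatrix to the indices of [L] itself, where two subsquares
    can be compared. *)
Lemma subsquares_symbols (T : finType) (n m : nat) (L : 'M[T]_n)
    (R C : {set 'I_n}) :
  (R, C) \in subsquares L m ->
  exists Y : {set T},
    [/\ #|R| = m, #|C| = m,
        forall i j, i \in R -> j \in C -> L i j \in Y,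
        forall i y, i \in R -> y \in Y -> exists2 j, j \in C & L i j = y
      & forall j y, j \in C -> y \in Y -> exists2 i, i \in R & L i j = y].
Proof.
rewrite inE /= => /andP[/eqP cardR /andP[/eqP cardRC /existsP[Y]]].
case/and4P=> _ /forallP AY /forall_inP rowY /forall_inP colY.
exists Y; split; rewrite -?cardRC //.
- move=> i j iR jC; have /forallP/(_ (enum_rank_in jC j)) := AY (enum_rank_in iR i).
  by rewrite mxE !enum_rankK_in.
- move=> i y iR /rowY/forallP/(_ (enum_rank_in iR i))/cards1P[j def_j].
  have : j \in [set j] by rewrite inE.
  rewrite -def_j inE mxE enum_rankK_in // => /eqP eq_y.
  by exists (enum_val j); first exact: enum_valP.
- move=> j y jC /colY/forallP/(_ (enum_rank_in jC j))/cards1P[i def_i].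
  have : i \in [set i] by rewrite inE.
  rewrite -def_i inE mxE enum_rankK_in // => /eqP eq_y.
  by exists (enum_val i); first exact: enum_valP.
Qed.

Lemma subsquares_eq (T : finType) (n m : nat) (L : 'M[T]_n)
    (R1 C1 R2 C2 H : {set 'I_n}) (c : 'I_n) :
  latin_square L ->
  (R1, C1) \in subsquares L m -> (R2, C2) \in subsquares L m ->
  c \in C1 -> c \in C2 -> H \subset R1 -> H \subset R2 -> (m < #|H|.*2)%N ->
  (R1, C1) = (R2, C2).
Proof.
move=> /latin_square_inj[rowI colI].
case/subsquares_symbols=> Y1 [cR1 cC1 inY1 row1 col1].
case/subsquares_symbols=> Y2 [cR2 cC2 inY2 row2 col2].
move=> c1 c2 HR1 HR2 ltmH.
have [r rH] : exists r, r \in H by apply/card_gt0P; lia.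
have r1 := subsetP HR1 _ rH; have r2 := subsetP HR2 _ rH.
(* The entries of column [c] in the rows of [H] are distinct and lie in both subsquares. *)
have leHY : (#|H| <= #|Y1 :&: Y2|)%N.
  rewrite -(card_imset (mem H) (colI c)); apply/subset_leq_card/subsetP.
  move=> _ /imsetP[i iH ->]; rewrite inE.
  by rewrite inY1 ?inY2 ?(subsetP HR1) ?(subsetP HR2).
(* Both subsquares contain row [r], so a common symbol sits there in a column of [C1] and in one of
   [C2]; these coincide, as row [r] of [L] has no repetition. *)
have leYC : (#|Y1 :&: Y2| <= #|C1 :&: C2|)%N.
  rewrite -(card_imset (mem (C1 :&: C2)) (rowI r)).
  apply/subset_leq_card/subsetP=> y /setIP[y1 y2].
  have [j j1 Lj] := row1 r y r1 y1; have [k k2 Lk] := row2 r y r2 y2.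
  have eq_jk : j = k by apply: (rowI r); rewrite Lj Lk.
  by apply/imsetP; exists j; rewrite ?inE ?j1 ?eq_jk.
have sR12 : R1 \subset R2.
  apply/subsetP=> i i1; apply: contraLR ltmH => i2; rewrite -leqNgt.
  (* A common symbol of row [i] in a column of [C2] would also occur in that column at a row of
     [R2], which would have to be [i]. *)
  have leYD : (#|Y1 :&: Y2| <= #|C1 :\: C2|)%N.
    rewrite -(card_imset (mem (C1 :\: C2)) (rowI i)).
    apply/subset_leq_card/subsetP=> y /setIP[y1 y2].
    have [j j1 Lj] := row1 i y i1 y1; apply/imsetP; exists j => //.
    rewrite !inE j1 andbT; apply: contra i2 => j2.
    have [k k2 Lk] := col2 j y j2 y2.
    by have -> : i = k by apply: (colI j); rewrite Lj Lk.
  have := cardsID C2 C1; lia.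
have eqR : R1 = R2 by apply/eqP; rewrite eqEcard sR12 cR1 cR2 leqnn.
congr pair => //; apply/eqP; rewrite eqEcard cC1 cC2 leqnn andbT.
(* With equal row sets, the shared column [c] carries all symbols of both squares, so [L r j] also
   occurs in row [r] within [C2], necessarily at [j]. *)
apply/subsetP=> j j1; have [i iR Li] := col1 c _ c1 (inY1 r j r1 j1).
have y2 : L r j \in Y2 by rewrite -Li inY2 -?eqR.
have [k k2 Lk] := row2 r _ r2 y2.
by rewrite -(rowI r _ _ Lk).
Qed.

(** Double counting: after exchanging the sums, each [u] of [X] contributes at most one index. *)
Lemma leq_sum_card_disjoint (I U : finType) (P : {set I}) (F : I -> {set U})
    (X : {set U}) :
  (forall i, i \in P -> F i \subset X) ->
  (forall i j u, i \in P -> j \in P -> u \in F i -> u \in F j -> i = j) ->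
  (\sum_(i in P) #|F i| <= #|X|)%N.
Proof.
move=> sFX injF.
have -> : (\sum_(i in P) #|F i| = \sum_(i in P) \sum_(u in X) (u \in F i))%N.
  apply: eq_bigr => i iP; rewrite -big_mkcondr sum1dep_card.
  apply: eq_card => u; rewrite !inE andbC.
  by case: (boolP (u \in F i)) => // /(subsetP (sFX i iP)).
rewrite exchange_big /= -sum1_card; apply: leq_sum => u _.
rewrite -big_mkcondr sum1dep_card; apply/card_le1_eqP => i j.
by rewrite !inE => /andP[iP ui] /andP[jP uj]; exact: (injF _ _ u).
Qed.

(* h = ceil((m + 1) / 2) *)
Theorem theorem2p1 (m n : nat) (hm : (0 < m)%N) (hn : (0 < n)%N)
    (T : finType) (L : 'M[T]_n) (hL : latin_square L) :
  let h := uphalf m.+1 in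
  (#|subsquares L m|)%:R <=
    (n * 'C(n, h))%:R / (m * 'C(m, h))%:R :> rat.
Proof.
cbv zeta; set h := uphalf m.+1.
(* The first bound feeds [subsquares_eq]; the second makes the denominator positive. *)
have [lemh lehm] : (m < h.*2)%N /\ (h <= m)%N by rewrite /h; lia.
rewrite ler_pdivlMr; last by rewrite ltr0n muln_gt0 hm bin_gt0.
rewrite -natrM ler_nat.
pose draws (R : {set 'I_n}) := [set H : {set 'I_n} | H \subset R & #|H| == h].
pose F (RC : {set 'I_n} * {set 'I_n}) := setX RC.2 (draws RC.1).
have cardF RC : RC \in subsquares L m -> #|F RC| = (m * 'C(m, h))%N.
  case: RC => R C /subsquares_symbols[_ [cR cC _ _ _]].
  by rewrite cardsX cards_draws cR cC.
rewrite -sum_nat_const -(eq_bigr _ cardF).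
have -> : (n * 'C(n, h))%N = #|setX [set: 'I_n] (draws [set: 'I_n])|.
  by rewrite cardsX cards_draws cardsT card_ord.
apply: leq_sum_card_disjoint => [RC _ | [R1 C1] [R2 C2] [c H] sq1 sq2].
  by apply/subsetP=> -[c H]; rewrite !inE subsetT => /and3P[].
rewrite !inE /= => /and3P[c1 H1 /eqP cardH] /and3P[c2 H2 _].
by apply: subsquares_eq hL sq1 sq2 c1 c2 H1 H2 _; rewrite cardH.
Qed.
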